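(* Let $n,m\ge 1$ and consider the bilinear system of $n+m$ equations in the variables $(x_0:\dots:x_n)\in\mathbb{P}^n$, $(y_0:\dots:y_m)\in\mathbb{P}^m$: \[F_k=\sum_{i=0}^n\sum_{j=0}^m a^{(k)}_{i,j}x_iy_j=0,\qquad 1\le k\le n+m,\] with indeterminate coefficients $a^{(k)}_{i,j}$. Let $\Delta$ denote its discriminant. Let $M_x$ be the $(n+m)(n+1)\times(m+1)$ matrix whose rows are indexed by pairs $(k,i)$ with $1\le k\le n+m$, $0\le i\le n$, whose columns are indexed by $j=0,\dots,m$ (corresponding to the variables $y_0,\dots,y_m$), and whose $((k,i),j)$ entry is $a^{(k)}_{i,j}$; i.e. row $(k,i)$ is the coefficient vector of the linear form $\partial F_k/\partial x_i=\sum_j a^{(k)}_{i,j}y_j$. Then $\Delta$ lies in the ideal of the polynomial ring $\mathbb{C}[a^{(k)}_{i,j}]$ generated by the maximal (i.e. $(m+1)\times(m+1)$) minors of $M_x$. Symmetrically, $\Delta$ lies in the ideal generated by the maximal ($(n+1)\times(n+1)$) minors of the $(n+m)(m+1)\times(n+1)$ matrix $M_y$ whose row $(k,j)$ ($1\le k\le n+m$, $0\le j\le m$) is the coefficient vector $(a^{(k)}_{0,j},\dots,a^{(k)}_{n,j})$ of $\partial F_k/\partial y_j=\sum_i a^{(k)}_{i,j}x_i$.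
   Context: The discriminant of the system is the irreducible polynomial (with coprime integer coefficients, defined up to sign) in the coefficients $a^{(k)}_{i,j}$ which vanishes whenever the system has a multiple (singular) solution in $\mathbb{P}^n\times\mathbb{P}^m$ over $\mathbb{C}$, i.e. a common zero at which the $(n+m)\times(n+m)$ Jacobian matrix of $F_1,\dots,F_{n+m}$ with respect to the affine coordinates (dehomogenized variables) is singular. *)

(* Defs.v *)
From HB Require Import structures.
From mathcomp Require Import all_boot all_algebra.
From mathcomp Require Import complex.
From mathcomp Require Import Rstruct.
From mathcomp Require Import mpoly.
Set Implicit Arguments. Unset Strict Implicit. Unset Printing Implicit Defensive.
Import GRing.Theory.
Local Open Scope ring_scope.

Notation Cplx := (complex Rdefinitions.R).

Definition coef_idx (n m : nat) : finType :=
  ('I_(n + m) * 'I_n.+1 * 'I_m.+1)%type.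

Definition nvars (n m : nat) : nat := #|coef_idx n m|.

Definition avar (R : nzRingType) (n m : nat) (k : 'I_(n + m)) (i : 'I_n.+1)
  (j : 'I_m.+1) : {mpoly R[nvars n m]} :=
  'X_(enum_rank ((k, i, j) : coef_idx n m)).

Definition coef_of (n m : nat) (a : 'I_(n + m) -> 'I_n.+1 -> 'I_m.+1 -> Cplx)
  : 'I_(nvars n m) -> Cplx :=
  fun v => let: (k, i, j) := enum_val v in a k i j.

Definition Fk (n m : nat) (a : 'I_(n + m) -> 'I_n.+1 -> 'I_m.+1 -> Cplx)
  (k : 'I_(n + m)) (x : 'I_n.+1 -> Cplx) (y : 'I_m.+1 -> Cplx) : Cplx :=
  \sum_(i < n.+1) \sum_(j < m.+1) a k i j * x i * y j.

(* Jacobian of F_1..F_{n+m} at (x,y) with respect to the affine coordinates of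
   the chart {x_p <> 0} x {y_q <> 0}, i.e. with respect to the variables
   x_i (i <> p) and y_j (j <> q); columns 'I_(n+m) = 'I_n (+) 'I_m.
   In the chart, with x'_i = x_i/x_p, y'_j = y_j/y_q, the dehomogenized
   f_k(x',y') = sum a^(k)_{ij} x'_i y'_j, so df_k/dx'_i = sum_j a^(k)_{ij} y'_j
   and df_k/dy'_j = sum_i a^(k)_{ij} x'_i, evaluated at (x', y'). *)
Definition affine_jacobian (n m : nat)
  (a : 'I_(n + m) -> 'I_n.+1 -> 'I_m.+1 -> Cplx)
  (x : 'I_n.+1 -> Cplx) (y : 'I_m.+1 -> Cplx) (p : 'I_n.+1) (q : 'I_m.+1)
  : 'M[Cplx]_(n + m) :=
  \matrix_(k < n + m, c < n + m)
    match split c with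
    | inl i => \sum_(j < m.+1) a k (lift p i) j * (y j / y q)
    | inr j => \sum_(i < n.+1) a k i (lift q j) * (x i / x p)
    end.

(* The system with coefficients a has a multiple (singular) solution in
   P^n x P^m: a common zero (x,y), x <> 0, y <> 0, at which the Jacobian with
   respect to affine coordinates (in a chart containing the point) is
   singular. *)
Definition has_singular_solution (n m : nat)
  (a : 'I_(n + m) -> 'I_n.+1 -> 'I_m.+1 -> Cplx) : Prop :=
  exists (x : 'I_n.+1 -> Cplx) (y : 'I_m.+1 -> Cplx) (p : 'I_n.+1) (q : 'I_m.+1),
    [/\ x p != 0, y q != 0,
        (forall k, Fk a k x y = 0) &
        \det (affine_jacobian a x y p q) = 0].

Definition irreducible_mpoly (N : nat) (P : {mpoly int[N]}) : Prop :=
  [/\ P != 0, P \isn't a GRing.unit &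
      forall Q1 Q2 : {mpoly int[N]}, P = Q1 * Q2 ->
        Q1 \is a GRing.unit \/ Q2 \is a GRing.unit].

Definition coprime_coefs (N : nat) (P : {mpoly int[N]}) : Prop :=
  forall d : int, (forall mo, (d %| P@_mo)%Z) -> d = 1 \/ d = -1.

Definition mpolyC_of_int (N : nat) (P : {mpoly int[N]}) : {mpoly Cplx[N]} :=
  map_mpoly (fun z : int => z%:~R : Cplx) P.

(* Delta is (a choice of sign of) the discriminant of the bilinear system:
   an irreducible polynomial in Z[a^(k)_{i,j}] with coprime coefficients which
   vanishes at every coefficient vector for which the system has a singular
   solution. *)
Definition is_bilinear_discriminant (n m : nat) (D : {mpoly int[nvars n m]})
  : Prop :=
  [/\ irreducible_mpoly D, coprime_coefs D &
      forall a : 'I_(n + m) -> 'I_n.+1 -> 'I_m.+1 -> Cplx,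
        has_singular_solution a -> (mpolyC_of_int D).@[coef_of a] = 0].

Definition minor_Mx (n m : nat) (sel : {ffun 'I_m.+1 -> 'I_(n + m) * 'I_n.+1})
  : {mpoly Cplx[nvars n m]} :=
  \det (\matrix_(r < m.+1, j < m.+1) avar Cplx (sel r).1 (sel r).2 j).

Definition minor_My (n m : nat) (sel : {ffun 'I_n.+1 -> 'I_(n + m) * 'I_m.+1})
  : {mpoly Cplx[nvars n m]} :=
  \det (\matrix_(r < n.+1, i < n.+1) avar Cplx (sel r).1 i (sel r).2).

(* Membership in the ideal of C[a] generated by a finite family of elements.
   (Row selections that are not injective give zero minors and reorderings
   only change signs, so the family of all minor_Mx sel generates exactly the
   ideal of maximal minors of M_x.) *)
Definition in_ideal_gen (N : nat) (I : finType) (g : I -> {mpoly Cplx[N]})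
  (P : {mpoly Cplx[N]}) : Prop :=
  exists c : I -> {mpoly Cplx[N]}, P = \sum_(s : I) c s * g s.

(* Main.v *)
(** The entries of [M_x] are pairwise distinct variables, and a kernel vector
    [y <> 0] of [M_x] makes every [(x, y)] a zero at which the [x]-columns of the
    Jacobian vanish.  So the discriminant vanishes wherever [M_x] is rank-deficient,
    and it suffices that, for a generic [N x p] matrix over an infinite field, a
    polynomial [P] vanishing on the rank-deficient matrices lies in the ideal of
    maximal minors.

    Induct on [N], writing [P] as a polynomial in the corner entry [v].  Its leading
    coefficient vanishes whenever the matrix without the first row and column is
    rank-deficient (let [v] tend to infinity along a curve of rank-deficient
    matrices), so by induction it is a combination of minors of that smaller matrix.
    Each of these is the coefficient of [v] in a maximal minor of the full matrix,
    and subtracting lowers the degree in [v].  Once [P] is free of [v], it vanishes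
    on the rank-deficient matrices with [N - 1] rows. *)
Require Import Defs.
From HB Require Import structures.
From mathcomp Require Import all_boot all_algebra.
From mathcomp Require Import complex.
From mathcomp Require Import Rstruct.
From mathcomp Require Import mpoly.
Import GRing.Theory.
Local Open Scope ring_scope.

Set Implicit Arguments.
Unset Strict Implicit.

(** * Polynomials determined by their values *)

(** In characteristic zero the values 1, 2, 3, ... supply more roots than the degree allows.
    Excluding t = 0 makes room for curves with a pole there. *)
Lemma poly_vanish_nz (F : numFieldType) (p : {poly F}) :
  (forall t, t != 0 -> p.[t] = 0) -> p = 0.
Proof.
move=> p_van; apply/eqP/negPn/negP => p_neq0.
pose s : seq F := [seq i.+1%:R | i <- iota 0 (size p)].
have : (size s < size p)%N.
  apply: max_poly_roots => //.
    apply/allP=> _ /mapP [i _ ->]; rewrite rootE p_van //.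
    by rewrite Num.Theory.pnatr_eq0.
  rewrite map_inj_uniq ?iota_uniq // => i j /eqP.
  by rewrite Num.Theory.eqr_nat => /eqP [].
by rewrite size_map size_iota ltnn.
Qed.

Lemma rmorph_mpoly_ext (R : comNzRingType) (S : nzRingType) (K : nat)
    (phi psi : {rmorphism {mpoly R[K]} -> S}) :
    (forall c, phi c%:MP = psi c%:MP) -> (forall i, phi 'X_i = psi 'X_i) ->
  phi =1 psi.
Proof.
move=> eqC eqX P; rewrite (mpolyE P) !rmorph_sum; apply: eq_bigr => m _.
rewrite -mul_mpolyC !rmorphM eqC; congr (_ * _).
rewrite mpolyXE_id !rmorph_prod; apply: eq_bigr => i _.
by rewrite !rmorphXn eqX.
Qed.

(** Induction on the number of variables: seen as a univariate polynomial in ['X_ord0], P has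
    coefficients that vanish at every point of the remaining variables. *)
Lemma mpoly_vanish_eq0 (F : numFieldType) (K : nat) (P : {mpoly F[K]}) :
  (forall a, P.@[a] = 0) -> P = 0.
Proof.
elim: K P => [|K IHK] P P_van.
  by have := P_van (fun=> 0); rewrite (nvar0_mpolyC P) mevalC => ->; rewrite mpolyC0.
pose to_poly : {rmorphism {mpoly F[K.+1]} -> {poly {mpoly F[K]}}} :=
  mmap (polyC \o @mpolyC K F)
    (fun i => if unlift ord0 i is Some j then ('X_j)%:P else 'X).
pose shift : {rmorphism {mpoly F[K]} -> {mpoly F[K.+1]}} :=
  mmap (@mpolyC K.+1 F) (fun j => 'X_(lift ord0 j)).
have to_polyK : P = (map_poly shift (to_poly P)).['X_ord0].
  apply: (@rmorph_mpoly_ext _ _ _ idfun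
    (horner_eval 'X_ord0 \o map_poly shift \o to_poly)) => [c|i] /=;
    rewrite /horner_eval.
    by rewrite mmapC map_polyC hornerC /= mmapC.
  rewrite mmapX mmap1U; case: unliftP => [j|] ->.
    by rewrite map_polyC hornerC /= mmapX mmap1U.
  by rewrite map_polyX hornerX.
suff to_poly0 : to_poly P = 0 by rewrite to_polyK to_poly0 rmorph0 horner0.
apply/polyP => k; rewrite coef0; apply: IHK => a.
rewrite -coef_map; suff -> : map_poly (meval a) (to_poly P) = 0 by rewrite coef0.
apply: poly_vanish_nz => t _.
rewrite -[RHS](P_van (fun i => if unlift ord0 i is Some j then a j else t)).
apply: (@rmorph_mpoly_ext _ _ _ (horner_eval t \o map_poly (meval a) \o to_poly)
  (meval _)) => [c|i] /=; rewrite /horner_eval.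
  by rewrite mmapC map_polyC hornerC /= !mevalC.
rewrite mmapX mmap1U mevalXU; case: unliftP => [j _|_].
  by rewrite map_polyC hornerC /= mevalXU.
by rewrite map_polyX hornerX.
Qed.

(** * Ideals generated by finite families *)

Section InIdeal.
Variables (R : comNzRingType) (I : finType) (g : I -> R).

Definition in_ideal (P : R) : Prop := exists c : I -> R, P = \sum_i c i * g i.

Lemma in_idealD P Q : in_ideal P -> in_ideal Q -> in_ideal (P + Q).
Proof.
move=> [c ->] [d ->]; exists (fun i => c i + d i).
by rewrite -big_split; apply: eq_bigr => i _; rewrite mulrDl.
Qed.

Lemma in_idealM P Q : in_ideal P -> in_ideal (Q * P).
Proof.
move=> [c ->]; exists (fun i => Q * c i).
by rewrite mulr_sumr; apply: eq_bigr => i _; rewrite mulrA.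
Qed.

Lemma gen_in_ideal i : in_ideal (g i).
Proof.
exists (fun j => (j == i)%:R); rewrite (bigD1 i) //= eqxx mul1r big1 ?addr0 //.
by move=> j /negbTE ->; rewrite mul0r.
Qed.

Lemma in_ideal0 : in_ideal 0.
Proof. by exists (fun=> 0); rewrite big1 // => i _; rewrite mul0r. Qed.

Lemma in_ideal_sum (J : finType) (h : J -> R) :
  (forall j, in_ideal (h j)) -> in_ideal (\sum_j h j).
Proof.
by move=> hP; apply: (big_ind in_ideal); [exact: in_ideal0|exact: in_idealD|].
Qed.

End InIdeal.

Lemma in_ideal_sub (R : comNzRingType) (I J : finType) (g : I -> R)
    (h : J -> R) (P : R) :
  (forall i, exists j, g i = h j) -> in_ideal g P -> in_ideal h P.
Proof.
move=> gh [c ->]; apply: in_ideal_sum => i; apply: in_idealM.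
by have [j ->] := gh i; exact: gen_in_ideal.
Qed.

(** * Isolating one variable *)

Section FreeOfVariable.
Variables (F : numFieldType) (K : nat) (v : 'I_K).
Implicit Types P Q : {mpoly F[K]}.

(** The equation [kill v P = P] is how later statements express that P does not involve v. *)
Definition kill P : {mpoly F[K]} :=
  mmap (@mpolyC K F) (fun i => if i == v then 0 else 'X_i) P.

HB.instance Definition _ := GRing.RMorphism.copy kill
  (mmap (@mpolyC K F) (fun i => if i == v then 0 else 'X_i)).

Lemma killC c : kill c%:MP = c%:MP.
Proof. exact: mmapC. Qed.

Lemma killX i : kill 'X_i = if i == v then 0 else 'X_i.
Proof. by rewrite /kill mmapX mmap1U. Qed.

Lemma killK P : kill (kill P) = kill P.
Proof.
apply: (@rmorph_mpoly_ext _ _ _ (kill \o kill) kill) => [c|i] /=.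
  by rewrite !killC.
by rewrite !killX; case: ifP => iv; rewrite ?rmorph0 ?killX ?iv.
Qed.

Lemma meval_kill P (a b : 'I_K -> F) : kill P = P ->
  (forall i, i != v -> a i = b i) -> P.@[a] = P.@[b].
Proof.
move=> <- ab.
apply: (@rmorph_mpoly_ext _ _ _ (meval a \o kill) (meval b \o kill)) => [c|i] /=.
  by rewrite !killC !mevalC.
rewrite !killX; case: ifPn => iv; rewrite ?rmorph0 //.
by rewrite !mevalXU ab.
Qed.

(** The coefficients stay in [{mpoly F[K]}], so no variable is renumbered; [kill_coef_as_poly]
    records that they avoid v. *)
Definition as_poly P : {poly {mpoly F[K]}} :=
  mmap (polyC \o @mpolyC K F) (fun i => if i == v then 'X else ('X_i)%:P) P.

HB.instance Definition _ := GRing.RMorphism.copy as_poly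
  (mmap (polyC \o @mpolyC K F) (fun i => if i == v then 'X else ('X_i)%:P)).

Lemma as_polyC c : as_poly c%:MP = (c%:MP)%:P.
Proof. exact: mmapC. Qed.

Lemma as_polyX i : as_poly 'X_i = if i == v then 'X else ('X_i)%:P.
Proof. by rewrite /as_poly mmapX mmap1U. Qed.

Lemma as_polyK P : (as_poly P).['X_v] = P.
Proof.
apply: (@rmorph_mpoly_ext _ _ _ (horner_eval 'X_v \o as_poly) idfun) => [c|i] /=;
  rewrite /horner_eval.
  by rewrite as_polyC hornerC.
by rewrite as_polyX; case: eqP => [->|_]; rewrite ?hornerX ?hornerC.
Qed.

Lemma kill_coef_as_poly P k : kill (as_poly P)`_k = (as_poly P)`_k.
Proof.
suff -> : as_poly P = map_poly kill (as_poly P) by rewrite coef_map /= killK.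
symmetry.
apply: (@rmorph_mpoly_ext _ {poly {mpoly F[K]}} _
  (map_poly kill \o as_poly) as_poly) => [c|i] /=.
  by rewrite !as_polyC map_polyC /= killC.
by rewrite !as_polyX; case: ifP => iv; rewrite ?map_polyX ?map_polyC //= killX iv.
Qed.

End FreeOfVariable.

Lemma horner_mmap (F : numFieldType) (K : nat) (g : 'I_K -> {poly F})
    (P : {mpoly F[K]}) t :
  (mmap polyC g P).[t] = P.@[fun i => (g i).[t]].
Proof.
apply: (@rmorph_mpoly_ext _ _ _ (horner_eval t \o mmap polyC g)
  (meval (fun i => (g i).[t]))) => [c|i] /=; rewrite /horner_eval.
  by rewrite mmapC mevalC hornerC.
by rewrite mmapX mmap1U mevalXU.
Qed.

(** * Polynomials vanishing on rank-deficient matrices *)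

Section DegenerateMatrices.
Variable F : numFieldType.

(** Entry (r, j) of the matrix is the variable [f r j], and variables outside the image of f are
    parameters. Passing to a submatrix thus changes f but not the ring. *)
Definition vanishes_on_degenerate (K N p : nat) (f : 'I_N -> 'I_p -> 'I_K)
    (P : {mpoly F[K]}) : Prop :=
  forall (a : 'I_K -> F) (y : 'I_p -> F), (exists j, y j != 0) ->
    (forall r, \sum_j a (f r j) * y j = 0) -> P.@[a] = 0.

Definition maxminor (K N p : nat) (f : 'I_N -> 'I_p -> 'I_K)
    (s : {ffun 'I_p -> 'I_N}) : {mpoly F[K]} :=
  \det (\matrix_(i, j) 'X_(f (s i) j)).

Definition injective2 (K N p : nat) (f : 'I_N -> 'I_p -> 'I_K) : Prop :=
  forall r j r' j', f r j = f r' j' -> r = r' /\ j = j'.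

Definition drop_row (K N p : nat) (f : 'I_N.+1 -> 'I_p -> 'I_K) :=
  fun r => f (lift ord0 r).

Definition drop_row_col (K N p : nat) (f : 'I_N.+1 -> 'I_p.+1 -> 'I_K) :=
  fun r j => f (lift ord0 r) (lift ord0 j).

Section Step.
Variables (K N q : nat) (f : 'I_N.+1 -> 'I_q.+1 -> 'I_K).
Hypothesis f_inj : injective2 f.
Let v := f ord0 ord0.
Variable c : {poly {mpoly F[K]}}.
Hypothesis c_free : forall k, kill v c`_k = c`_k.
Hypothesis c_van : vanishes_on_degenerate f c.['X_v].
Variable e : nat.
Hypothesis size_c : (size c <= e.+1)%N.

Lemma lead_coef_vanish_generic (a : 'I_K -> F) (z : 'I_q -> F) (j0 : 'I_q) :
  z j0 != 0 ->
  (forall r, \sum_j a (drop_row_col f r j) * z j = 0) ->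
  \sum_j a (f ord0 (lift ord0 j)) * z j != 0 ->
  (c`_e).@[a] = 0.
Proof.
move=> zj0 az; set w := \sum_j _ => w_neq0.
(* In each row below row 0, the first column contributes -t times its entry against (- t, z). The
   correction in column j0, divided by [z j0], cancels exactly this. *)
pose g i : {poly F} :=
  if [pick r | i == drop_row_col f r j0] is Some r
  then (a i)%:P + (a (f (lift ord0 r) ord0) / z j0) *: 'X else (a i)%:P.
have gE r j : g (f (lift ord0 r) (lift ord0 j)) =
   (a (f (lift ord0 r) (lift ord0 j)))%:P +
     (if j == j0 then a (f (lift ord0 r) ord0) / z j0 else 0) *: 'X.
  rewrite /g; case: pickP => [r' /eqP /f_inj [/lift_inj <- /lift_inj ->]|].
    by rewrite eqxx.
  move=> /(_ r); rewrite /drop_row_col; case: (j =P j0) => [->|_ _].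
    by rewrite eqxx.
  by rewrite scale0r addr0.
have g0 i j : (i == ord0) || (j == ord0) -> g (f i j) = (a (f i j))%:P.
  rewrite /g; case: pickP => [r' /eqP /f_inj [-> ->]|//].
  by rewrite -!(inj_eq val_inj).
(* The kernel vector (- t, z) of the curve b t forces the entry v to be w / t;
   t ^ e * P (b t) is then a polynomial in t with value (c`_e).@[a] * w ^ e at 0. *)
pose b t i := if i == v then w / t else (g i).[t].
pose T : {poly F} :=
  \sum_(k < e.+1) mmap polyC g c`_k * (w ^+ k)%:P * 'X^(e - k).
have T0 : T.[0] = (c`_e).@[a] * w ^+ e.
  rewrite horner_sum big_ord_recr /= big1 => [|k _].
    rewrite add0r subnn expr0 mulr1 hornerM hornerC horner_mmap.
    congr (_ * _); apply: meval_eq => i; rewrite /g.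
    by case: pickP => [r _|_]; rewrite !hornerE ?mulr0 ?addr0.
  by rewrite hornerM hornerXn expr0n subn_eq0 leqNgt ltn_ord mulr0.
suff : T.[0] = 0.
  by move/eqP; rewrite T0 mulf_eq0 (negbTE (expf_neq0 _ w_neq0)) orbF => /eqP.
suff -> : T = 0 by rewrite horner0.
apply: poly_vanish_nz => t t_neq0.
have -> : T.[t] = t ^+ e * c.['X_v].@[b t].
  rewrite (horner_coef_wide _ size_c) rmorph_sum mulr_sumr horner_sum.
  apply: eq_bigr => k _; rewrite rmorphM [in RHS]rmorphXn /= mevalXU /b eqxx.
  rewrite !hornerM hornerXn hornerC horner_mmap expr_div_n.
  rewrite [in RHS](@meval_kill _ _ v _ _ (fun i => (g i).[t]) (c_free k)); last first.
    by move=> i /negbTE iv; rewrite /= iv.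
  rewrite [RHS]mulrC -!mulrA; congr (_ * (_ * _)).
  by rewrite mulrC expfB_cond ?(negbTE t_neq0) // -ltnS ltn_ord.
rewrite (@c_van _ (fun j => if unlift ord0 j is Some j' then z j' else - t)).
- by rewrite mulr0.
- by exists ord0; rewrite unlift_none oppr_eq0.
move=> r; rewrite big_ord_recl unlift_none.
under eq_bigr => j _ do rewrite liftK.
have b_neqv i j : (i != ord0) || (j != ord0) -> b t (f i j) = (g (f i j)).[t].
  move=> ij; rewrite /b; case: eqP => // /f_inj [i0 j0'].
  by rewrite i0 j0' eqxx in ij.
case: (unliftP ord0 r) => [r' ->|->].
  rewrite b_neqv ?neq_lift 1?eq_sym // g0 ?eqxx ?orbT // hornerC.
  under eq_bigr => j _ do
    rewrite b_neqv ?[_ == ord0]eq_sym ?neq_lift // gE !hornerE mulrDl.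
  rewrite big_split /= az add0r (bigD1 j0) //= eqxx big1 ?addr0; last first.
    by move=> j /negbTE ->; rewrite mul0r mul0r.
  by rewrite mulrAC divfK // mulrN addNr.
rewrite {1}/b eqxx mulrN divfK // -/w.
under eq_bigr => j _ do
  rewrite b_neqv ?[_ == ord0]eq_sym ?neq_lift ?orbT // g0 ?eqxx // hornerC.
by rewrite -/w addNr.
Qed.

Lemma lead_coef_vanish :
  vanishes_on_degenerate (drop_row_col f) c`_e.
Proof.
(* The generic case suffices: perturb the single entry u of row 0. *)
move=> a z [j0 zj0] az; set u := f ord0 (lift ord0 j0).
have [w0|] := eqVneq (\sum_j a (f ord0 (lift ord0 j)) * z j) 0; last first.
  exact: lead_coef_vanish_generic zj0 az.
pose g i : {poly F} := (a i)%:P + (i == u)%:R *: 'X.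
have gE i s : (g i).[s] = a i + (i == u)%:R * s by rewrite !hornerE.
suff : (mmap polyC g c`_e).[0] = 0.
  by rewrite horner_mmap => <-; apply: meval_eq => i; rewrite gE mulr0 addr0.
suff -> : mmap polyC g c`_e = 0 by rewrite horner0.
(* For s <> 0 the smaller matrix is unchanged, while the sum over row 0 moves from 0 to s * [z j0],
   which is nonzero. *)
apply: poly_vanish_nz => s s_neq0; rewrite horner_mmap.
apply: (lead_coef_vanish_generic zj0) => [r|].
  rewrite -[RHS](az r); apply: eq_bigr => j _; rewrite gE.
  by case: eqP => [/f_inj [/eqP]|_]; rewrite ?mul0r ?addr0 // -(inj_eq val_inj).
under eq_bigr => j _ do rewrite gE mulrDl.
rewrite big_split /= w0 add0r (bigD1 j0) //= /u eqxx mul1r big1 ?addr0.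
  by rewrite mulf_neq0.
move=> j jj0; case: eqP => [/f_inj [_ /lift_inj /eqP]|_].
  by rewrite (negbTE jj0).
by rewrite !mul0r.
Qed.

End Step.

(** * Maximal minors and the corner variable *)

Lemma maxminor_vanish (K N p : nat) (f : 'I_N -> 'I_p -> 'I_K) s :
  vanishes_on_degenerate f (maxminor f s).
Proof.
move=> a y [j yj] ay; rewrite -det_map_mx -det_tr; apply/eqP/det0P.
exists (\row_j y j).
  by apply/eqP => /rowP /(_ j) /eqP; rewrite !mxE (negbTE yj).
apply/rowP => i; rewrite !mxE -[RHS](ay (s i)); apply: eq_bigr => k _.
by rewrite !mxE /= mevalXU mulrC.
Qed.

Definition add_row0 (N q : nat) (s : {ffun 'I_q -> 'I_N}) :
    {ffun 'I_q.+1 -> 'I_N.+1} :=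
  [ffun i => if unlift ord0 i is Some i' then lift ord0 (s i') else ord0].

Lemma kill_maxminor_drop (K N q : nat) (f : 'I_N.+1 -> 'I_q.+1 -> 'I_K) s :
  injective2 f ->
  kill (f ord0 ord0) (maxminor (drop_row_col f) s) =
    maxminor (drop_row_col f) s.
Proof.
move=> f_inj; rewrite /maxminor -det_map_mx; congr (\det _).
apply/matrixP => i j; rewrite !mxE /= killX.
by case: eqP => // /f_inj [/eqP]; rewrite eq_sym (negbTE (neq_lift _ _)).
Qed.

(* Laplace expansion along row 0, sorted by the powers of the corner variable. *)
Lemma maxminor_add_row0 (K N q : nat) (f : 'I_N.+1 -> 'I_q.+1 -> 'I_K) s :
  injective2 f ->
  maxminor f (add_row0 s) =
    'X_(f ord0 ord0) * maxminor (drop_row_col f) s +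
    kill (f ord0 ord0) (maxminor f (add_row0 s)).
Proof.
move=> f_inj; set B := maxminor _ (add_row0 s).
have BE : B = 'X_(f ord0 ord0) * maxminor (drop_row_col f) s +
    \sum_(j < q) 'X_(f ord0 (lift ord0 j)) *
      cofactor (\matrix_(i, j) 'X_(f (add_row0 s i) j)) ord0 (lift ord0 j).
  rewrite /B /maxminor (expand_det_row _ ord0) big_ord_recl.
  congr (_ + _); last first.
    by apply: eq_bigr => j _; rewrite mxE ffunE unlift_none.
  rewrite mxE ffunE unlift_none /cofactor expr0 mul1r.
  congr (_ * \det _); apply/matrixP => i j.
  by rewrite !mxE ffunE liftK.
rewrite {1}BE; congr (_ + _); rewrite BE rmorphD rmorphM /= killX eqxx mul0r add0r.
rewrite rmorph_sum; apply: eq_bigr => j _; rewrite rmorphM /= killX.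
case: eqP => [/f_inj [_ /eqP]|_].
  by rewrite eq_sym (negbTE (neq_lift _ _)).
congr (_ * _); rewrite /cofactor rmorphM rmorphXn rmorphN1; congr (_ * _).
rewrite -det_map_mx; congr (\det _); apply/matrixP => i k.
rewrite !mxE ffunE liftK /= killX.
by case: eqP => // /f_inj [/eqP]; rewrite eq_sym (negbTE (neq_lift _ _)).
Qed.

(** * Induction on the rows and on the degree in the corner variable *)

Section Induction.
Variables (K N q : nat) (f : 'I_N.+1 -> 'I_q.+1 -> 'I_K).
Hypothesis f_inj : injective2 f.
Let v := f ord0 ord0.

Lemma vanish_drop_row P : kill v P = P ->
  vanishes_on_degenerate f P ->
  vanishes_on_degenerate (drop_row f) P.
Proof.
move=> P_free P_van a y [j yj] ay.
(* If y ord0 <> 0, row 0 can be made orthogonal to y by adjusting v alone. *)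
have [y0|y0] := eqVneq (y ord0) 0; last first.
  pose u := \sum_(j < q) a (f ord0 (lift ord0 j)) * y (lift ord0 j).
  pose b i := if i == v then - u / y ord0 else a i.
  rewrite (@meval_kill _ _ v P a b P_free) => [|i /negbTE iv]; last first.
    by rewrite /b iv.
  apply: (P_van _ y); first by exists j.
  move=> r; case: (unliftP ord0 r) => [r' ->|->]; last first.
    rewrite big_ord_recl {1}/b eqxx divfK // addrC; apply/eqP.
    rewrite subr_eq0; apply/eqP; apply: eq_bigr => k _; congr (_ * _); rewrite /b.
    by case: eqP => // /f_inj [_ /eqP]; rewrite eq_sym (negbTE (neq_lift _ _)).
  rewrite -[RHS](ay r'); apply: eq_bigr => k _; congr (_ * _); rewrite /b.
  by case: eqP => // /f_inj [/eqP]; rewrite eq_sym (negbTE (neq_lift _ _)).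
(* If [y ord0] = 0, the tail of y is a kernel vector of the matrix without row 0 and column 0. Being
   free of v, P is its own leading coefficient with e = 0. *)
rewrite (_ : P = (P%:P)`_0); last by rewrite coefC.
apply: (@lead_coef_vanish _ _ _ _ f_inj P%:P _ _ 0%N _ a
  (fun k => y (lift ord0 k))).
- by move=> k; rewrite coefC; case: ifP; rewrite ?rmorph0.
- by rewrite hornerC.
- exact: size_polyC_leq1.
- case: (unliftP ord0 j) yj => [j' ->|->]; first by exists j'.
  by rewrite y0 eqxx.
by move=> r; rewrite -[RHS](ay r) big_ord_recl y0 mulr0 add0r.
Qed.

Hypothesis IHrow : forall P, vanishes_on_degenerate (drop_row f) P ->
  in_ideal (maxminor (drop_row f)) P.
Hypothesis IHrow_col : forall P,
  vanishes_on_degenerate (drop_row_col f) P ->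
  in_ideal (maxminor (drop_row_col f)) P.

(** Stated for c rather than for its value at v, so that the degree bound and the v-free
    coefficients are carried through the induction on e. *)
Lemma in_ideal_step (e : nat) (c : {poly {mpoly F[K]}}) :
  (size c <= e.+1)%N -> (forall k, kill v c`_k = c`_k) ->
  vanishes_on_degenerate f c.['X_v] ->
  in_ideal (maxminor f) c.['X_v].
Proof.
elim: e c => [|e IHe] c size_c c_free c_van.
  move: c_van; rewrite (size1_polyC size_c) hornerC => c_van.
  apply: (in_ideal_sub (g := maxminor (drop_row f))).
    move=> s; exists [ffun i => lift ord0 (s i)]; congr (\det _).
    by apply/matrixP => i j; rewrite !mxE ffunE.
  exact/IHrow/vanish_drop_row.
have [d dE] := IHrow_col (lead_coef_vanish f_inj c_free c_van size_c).
(* Since the top coefficient and the small minors are free of v, [d s] may be replaced by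
   [kill v (d s)], which keeps S free of v. S collects the v-free parts of the enlarged minors; they
   enter Q in degree e. *)
pose S := \sum_s kill v (d s) * kill v (maxminor f (add_row0 s)).
pose Q := \sum_s kill v (d s) * 'X_v ^+ e * maxminor f (add_row0 s).
have QE : Q = c`_e.+1 * 'X_v ^+ e.+1 + S * 'X_v ^+ e.
  rewrite -(c_free e.+1) dE rmorph_sum !mulr_suml -big_split.
  apply: eq_bigr => s _; rewrite [in LHS]maxminor_add_row0 // -/v.
  rewrite rmorphM /= kill_maxminor_drop // mulrDr exprS.
  congr (_ + _); last exact: mulrAC.
  by rewrite -!mulrA; congr (_ * _); rewrite mulrCA mulrA mulrC.
(* Subtracting Q removes the term of degree e + 1 and alters only the coefficient of degree e, by
   S. *)
pose c' : {poly {mpoly F[K]}} := \poly_(k < e.+1) (c`_k - (if k == e then S else 0)).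
have cE : c.['X_v] = c'.['X_v] + Q.
  rewrite (horner_coef_wide _ size_c) horner_poly QE.
  rewrite [_ + S * _]addrC addrA big_ord_recr; congr (_ + _).
  rewrite !big_ord_recr /= eqxx mulrBl -addrA subrK; congr (_ + _).
  by apply: eq_bigr => k _; rewrite (ltn_eqF (ltn_ord k)) subr0.
have Q_in : in_ideal (maxminor f) Q.
  by apply: in_ideal_sum => s; apply: in_idealM; apply: gen_in_ideal.
rewrite cE; apply: in_idealD => //; apply: IHe; first exact: size_poly.
  move=> k; rewrite coef_poly; case: ifP => _; last by rewrite rmorph0.
  rewrite rmorphB /= c_free; congr (_ - _); case: ifP; rewrite ?rmorph0 //.
  by rewrite rmorph_sum => _; apply: eq_bigr => s _; rewrite rmorphM /= !killK.
have -> : c'.['X_v] = c.['X_v] - Q by rewrite cE addrK.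
move=> a y y0 ay; rewrite rmorphB /= (c_van _ _ y0 ay) sub0r; apply/eqP.
rewrite oppr_eq0 rmorph_sum big1 // => s _.
by rewrite rmorphM /= (maxminor_vanish _ y0 ay) mulr0.
Qed.

End Induction.

Lemma vanishes_on_degenerate_in_ideal (K N p : nat) (f : 'I_N -> 'I_p -> 'I_K)
    (P : {mpoly F[K]}) :
  injective2 f -> vanishes_on_degenerate f P ->
  in_ideal (maxminor f) P.
Proof.
elim: N p f P => [|N IHN] [|q] f P f_inj P_van.
(* Without columns the empty minor is 1, so the ideal is the whole ring. *)
- rewrite -[P]mulr1; apply: in_idealM.
  have <- : maxminor f [ffun i => i] = 1 by exact: det_mx00.
  exact: gen_in_ideal.
(* With columns but no rows every point is degenerate, so P = 0. *)
- rewrite (@mpoly_vanish_eq0 _ _ P); first exact: in_ideal0.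
  move=> a; apply: (P_van a (fun=> 1)); last by case.
  by exists ord0; exact: oner_neq0.
- rewrite -[P]mulr1; apply: in_idealM.
  have <- : maxminor f [ffun i => ord0] = 1 by exact: det_mx00.
  exact: gen_in_ideal.
rewrite -(as_polyK (f ord0 ord0) P).
(* Only an upper bound on the degree is required; taking e to be the size leaves a harmless
   slack. *)
apply: (@in_ideal_step _ _ _ _ f_inj _ _ (size (as_poly (f ord0 ord0) P))).
- by move=> Q; apply: IHN => r j r' j' /f_inj [/lift_inj -> ->].
- by move=> Q; apply: IHN => r j r' j' /f_inj [/lift_inj -> /lift_inj ->].
- exact: leqnSn.
- exact: kill_coef_as_poly.
- by rewrite as_polyK.
Qed.

End DegenerateMatrices.

(** Rows are indexed by a finite type so that the pairs (k, i) and (k, j) can serve directly. *)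
Lemma vanish_on_kernels_in_ideal (F : numFieldType) (K p : nat) (I : finType)
    (f : I -> 'I_p -> 'I_K) (P : {mpoly F[K]}) :
  (forall r j r' j', f r j = f r' j' -> r = r' /\ j = j') ->
  (forall (a : 'I_K -> F) (y : 'I_p -> F), (exists j, y j != 0) ->
     (forall r, \sum_j a (f r j) * y j = 0) -> P.@[a] = 0) ->
  in_ideal
    (fun s : {ffun 'I_p -> I} => \det (\matrix_(i, j) 'X_(f (s i) j))) P.
Proof.
move=> f_inj P_van; pose f' (r : 'I_#|I|) := f (enum_val r).
apply: (in_ideal_sub (g := maxminor F f')) => [s|].
  exists [ffun i => enum_val (s i)]; congr (\det _).
  by apply/matrixP => i j; rewrite !mxE ffunE.
apply: vanishes_on_degenerate_in_ideal => [r j r' j' /f_inj [/enum_val_inj -> ->]//|].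
move=> a y y0 ay; apply: P_van y0 _ => r.
by rewrite -[RHS](ay (enum_rank r)) /f' enum_rankK.
Qed.

(** * Singular solutions of the bilinear system *)

Lemma has_singular_solution_kerx (n m : nat)
    (a : 'I_(n + m) -> 'I_n.+1 -> 'I_m.+1 -> Cplx) (y : 'I_m.+1 -> Cplx) :
  (0 < n)%N -> (exists j, y j != 0) ->
  (forall k i, \sum_j a k i j * y j = 0) -> has_singular_solution a.
Proof.
move=> n_gt0 [q yq] ay; exists (fun=> 1), y, ord0, q; split=> //.
- exact: oner_neq0.
- move=> k; apply: big1 => i _; rewrite -[RHS](ay k i).
  by apply: eq_bigr => j _; rewrite mulr1.
(* The first x-column of the Jacobian, which exists because n > 0, is zero. *)
rewrite (expand_det_col _ (lshift m (Ordinal n_gt0))) big1 // => k _.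
rewrite mxE (unsplitK (inl (Ordinal n_gt0))).
under eq_bigr => j _ do rewrite mulrA.
by rewrite -mulr_suml ay !mul0r.
Qed.

Lemma has_singular_solution_kery (n m : nat)
    (a : 'I_(n + m) -> 'I_n.+1 -> 'I_m.+1 -> Cplx) (x : 'I_n.+1 -> Cplx) :
  (0 < m)%N -> (exists i, x i != 0) ->
  (forall k j, \sum_i a k i j * x i = 0) -> has_singular_solution a.
Proof.
move=> m_gt0 [p xp] ax; exists x, (fun=> 1), p, ord0; split=> //.
- exact: oner_neq0.
- move=> k; rewrite /Fk exchange_big; apply: big1 => j _; rewrite -[RHS](ax k j).
  by apply: eq_bigr => i _; rewrite mulr1.
rewrite (expand_det_col _ (rshift n (Ordinal m_gt0))) big1 // => k _.
rewrite mxE (unsplitK (inr (Ordinal m_gt0))).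
under eq_bigr => i _ do rewrite mulrA.
by rewrite -mulr_suml ax !mul0r.
Qed.

(** Every point of the coefficient space comes from a system, so the vanishing of D on singular
    systems transfers to arbitrary evaluation points. *)
Lemma coef_of_enum_rank (n m : nat) (b : 'I_(nvars n m) -> Cplx) :
  coef_of (fun k i j => b (enum_rank ((k, i, j) : coef_idx n m))) =1 b.
Proof.
move=> v; rewrite /coef_of; case E: (enum_val v) => [[k i] j].
by rewrite -E enum_valK.
Qed.

Unset Implicit Arguments.

Theorem theorem1 (n m : nat) (hn : (1 <= n)%N) (hm : (1 <= m)%N)
  (D : {mpoly int[nvars n m]}) :
  is_bilinear_discriminant D ->
  in_ideal_gen (@minor_Mx n m) (mpolyC_of_int D) /\
  in_ideal_gen (@minor_My n m) (mpolyC_of_int D).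
Proof.
move=> [_ _ D_van]; split.
- apply: (vanish_on_kernels_in_ideal
    (f := fun (r : 'I_(n + m) * 'I_n.+1) j =>
       enum_rank ((r.1, r.2, j) : coef_idx n m))).
    by move=> [k i] j [k' i'] j' /enum_rank_inj [-> -> ->].
  move=> b y y0 by0; rewrite -(meval_eq _ (coef_of_enum_rank b)).
  apply/D_van/(has_singular_solution_kerx hn y0) => k i.
  exact: (by0 (k, i)).
- apply: (vanish_on_kernels_in_ideal
    (f := fun (r : 'I_(n + m) * 'I_m.+1) i =>
       enum_rank ((r.1, i, r.2) : coef_idx n m))).
    by move=> [k j] i [k' j'] i' /enum_rank_inj [-> -> ->].
  move=> b x x0 bx0; rewrite -(meval_eq _ (coef_of_enum_rank b)).
  apply/D_van/(has_singular_solution_kery hm x0) => k j.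
  exact: (bx0 (k, j)).
Qed.
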